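(* Let $L$ be an infinite-dimensional Lie subalgebra of $\mathbb{W}_1$. Then there exist $f,g \in \Bbbk[t]$ with $f \notin \Bbbk$, $g \neq 0$, and $f'g \in \Bbbk[f]$ such that $$L(f,g) \subseteq L \subseteq L(f).$$ In particular, $L$ has finite codimension in $L(f)$. Moreover, $f$ and $g$ are unique under the normalisations: $f$ is monic with $f(0)=0$, and $g$ is monic of minimal degree such that $f'g\in\Bbbk[f]$ and $L(f,g) \subseteq L$. Precisely: if $\widetilde f, \widetilde g \in \Bbbk[t]$ (with $f'\widetilde g$, resp. $\widetilde f'\widetilde g$, in the appropriate $\Bbbk[\cdot]$) satisfy $L(\widetilde f,\widetilde g) \subseteq L \subseteq L(\widetilde f)$, then $\widetilde f = \alpha f + \beta$ for some $\alpha,\beta\in\Bbbk$ with $\alpha \neq 0$, and $\widetilde g = p(f)g$ for some $p \in \Bbbk[t]$. In particular $L(\widetilde f) = L(f)$ and $L(\widetilde f, \widetilde g) \subseteq L(f,g)$.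
   Context: $\Bbbk$ is a field of characteristic zero. $\mathbb{W}_1 = \mathrm{Der}(\Bbbk[t]) = \Bbbk[t]\partial$ with $\partial = d/dt$ and bracket $[f\partial, g\partial] = (fg'-f'g)\partial$. For $f,g \in \Bbbk[t]\setminus\{0\}$ with $f'g \in \Bbbk[f]$, write $L(f,g) = \Bbbk[f]\,g\partial$ (a Lie subalgebra of $\mathbb{W}_1$). For nonconstant $f$, let $g_f$ be the unique monic polynomial of minimal degree with $f'g_f \in \Bbbk[f]$, and put $L(f) = L(f,g_f)$. *)

(* Defs.v *)
From HB Require Import structures.
From mathcomp Require Import all_boot all_order all_algebra.
Set Implicit Arguments. Unset Strict Implicit. Unset Printing Implicit Defensive.
Import GRing.Theory.
Local Open Scope ring_scope.

(* The Witt algebra W_1 = k[t] d/dt is identified with {poly R}: the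
   polynomial f stands for the derivation f * d/dt. *)

Definition wbr (R : fieldType) (f g : {poly R}) : {poly R} :=
  f * g^`() - f^`() * g.

Definition in_kf (R : fieldType) (f h : {poly R}) : Prop :=
  exists p : {poly R}, h = p \Po f.

Definition Lfg (R : fieldType) (f g : {poly R}) (h : {poly R}) : Prop :=
  exists p : {poly R}, h = (p \Po f) * g.

Definition is_gf (R : fieldType) (f g : {poly R}) : Prop :=
  [/\ g \is monic, in_kf f (f^`() * g) &
      forall g' : {poly R}, g' \is monic -> in_kf f (f^`() * g') ->
        (size g <= size g')%N].

Definition Lf (R : fieldType) (f : {poly R}) (h : {poly R}) : Prop :=
  exists g, is_gf f g /\ Lfg f g h.

Definition psub (R : fieldType) (A B : {poly R} -> Prop) : Prop :=
  forall h, A h -> B h.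

Definition lie_subalg (R : fieldType) (L : {poly R} -> Prop) : Prop :=
  [/\ L 0,
      forall x y, L x -> L y -> L (x + y),
      forall (a : R) x, L x -> L (a *: x) &
      forall x y, L x -> L y -> L (wbr x y)].

Definition in_span (R : fieldType) (s : seq {poly R}) (v : {poly R}) : Prop :=
  exists c : 'I_(size s) -> R, v = \sum_(i < size s) c i *: s`_i.

Definition fin_dim (R : fieldType) (L : {poly R} -> Prop) : Prop :=
  exists s : seq {poly R}, forall v, L v -> in_span s v.

(* L has finite codimension in M (for L a subspace of M):
   M is contained in L + span(s) for some finite family s *)
Definition fin_codim (R : fieldType) (L M : {poly R} -> Prop) : Prop :=
  exists s : seq {poly R}, forall v, M v ->
    exists u w, L u /\ in_span s w /\ v = u + w.

(* Main.v *)
Require Import Defs.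
From mathcomp Require Import all_boot all_order all_algebra.
From mathcomp Require Import polyXY zify ring.
From Stdlib Require Import Classical.
Import GRing.Theory.
Local Open Scope ring_scope.

(* The multipliers of L are the polynomials p with p L <= L.  L has a
   nonconstant one: by a dimension count there are a_j, b_j in L such that
   sum_j a_j(x) b_j(y) is nonzero and divisible by (x - y)^3.  Replacing each
   a_j by [c, a_j] lowers the order of vanishing on the diagonal by exactly one,
   and once the order is two the operator sum_j ad a_j ad b_j is multiplication
   by a nonzero polynomial divisible by c.

   For a multiplier b and x in L, b' x is again a multiplier, since
   [x, b y] - b [x, y] = b' x y.  Hence the polynomials which are quotients of
   multipliers form an algebra C stable under x d/dt for x in L, and
   C = k[f] by the polynomial case of Lueroth's theorem.  Therefore f' L <= k[f],
   that is L <= L(f); and since k[f] is finite over k[p], some nonzero multiplier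
   r satisfies r k[f] L <= L, which gives L(f, g) <= L.  Uniqueness holds because
   L(f, g) <= L <= L(f) makes f a quotient of two elements of L, so that either
   of two such polynomials f is a polynomial in the other. *)

(** * Irreducible factors and contents of bivariate polynomials *)

Lemma prop_min_nat (P : nat -> Prop) :
  (exists n, P n) -> exists n, P n /\ forall m, P m -> (n <= m)%N.
Proof.
move=> [n]; elim/ltn_ind: n => n IH Pn.
have [[m [Pm ltmn]]|H] := classic (exists m, P m /\ (m < n)%N); first exact: IH Pm.
exists n; split=> // m Pm; rewrite leqNgt; apply/negP=> ltmn; by apply: H; exists m.
Qed.

Lemma exists_irredp (R : fieldType) (a : {poly R}) :
  (1 < size a)%N -> exists2 p, irreducible_poly p & p %| a.
Proof.
move=> sa; pose P n := exists q : {poly R}, [/\ size q = n, (1 < n)%N & q %| a].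
have [n [[q [sq n1 qa]] nmin]] : exists n, P n /\ forall m, P m -> (n <= m)%N.
  by apply: prop_min_nat; exists (size a), a.
exists q => //; split=> [|r sr rq]; first by rewrite sq.
have q0 : q != 0 by rewrite -size_poly_gt0 sq ltnW.
have r0 : r != 0 by apply: contraTneq rq => ->; rewrite dvd0p.
rewrite -dvdp_size_eqp // eqn_leq dvdp_leq //= sq; apply: nmin.
exists r; split=> //; last exact: dvdp_trans qa.
by have := r0; rewrite -size_poly_gt0; case: (size r) sr => [|[]].
Qed.

Lemma irredp_dvdpM {R : fieldType} {p a b : {poly R}} :
  irreducible_poly p -> p %| a * b -> (p %| a) || (p %| b).
Proof.
move=> irr; case: (boolP (coprimep p a)) => [cop|ncop].
  by rewrite Gauss_dvdpr // => ->; rewrite orbT.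
move=> _; have /eqp_dvdl <- : gcdp p a %= p by apply: irr => //; apply: dvdp_gcdl.
by rewrite dvdp_gcdr.
Qed.

Definition content_dvd {R : fieldType} (d : {poly R}) (Q : {poly {poly R}}) :=
  forall i, d %| Q`_i.

Lemma content_dvdP {R : fieldType} (d : {poly R}) (Q : {poly {poly R}}) :
  content_dvd d Q -> exists Q1, Q = d *: Q1.
Proof.
move=> dQ; exists (\poly_(i < size Q) (Q`_i %/ d)).
apply/polyP=> i; rewrite coefZ coef_poly; case: ltnP => [_|/leq_sizeP-> //].
  by rewrite mulrC divpK.
by rewrite mulr0.
Qed.

(** If [i] and [j] are the first indices at which [p] fails to divide the coefficients of [Q] and
    [S], the coefficient of [Q * S] at [i + j] is congruent to [Q_i * S_j] modulo [p]. *)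
Lemma irredp_content_dvdM {R : fieldType} {p : {poly R}} {Q S : {poly {poly R}}} :
  irreducible_poly p -> content_dvd p (Q * S) -> content_dvd p Q \/ content_dvd p S.
Proof.
move=> irr pQS; apply: NNPP => /not_or_and[nQ nS].
have mini (T : {poly {poly R}}) : ~ content_dvd p T ->
    exists n, ~~ (p %| T`_n) /\ forall m, (m < n)%N -> p %| T`_m.
  move=> /not_all_ex_not[k /negP pk].
  have [|n [pn nmin]] := @prop_min_nat (fun n => ~~ (p %| T`_n)); first by exists k.
  exists n; split=> // m ltmn; apply: contraLR ltmn => /nmin; by rewrite -leqNgt.
have [i [pi mi]] := mini Q nQ; have [j [pj mj]] := mini S nS.
have := pQS (i + j)%N; rewrite coefM.
have ltij : (i < (i + j).+1)%N by rewrite ltnS leq_addr.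
rewrite (bigD1 (Ordinal ltij)) //= addKn dvdp_addl.
  by move/(irredp_dvdpM irr); rewrite (negPf pi) (negPf pj).
elim/big_ind: _ => [|x y px py|k /negP nk]; [exact: dvdp0 | exact: dvdp_add |].
have [ltki|leik] := ltnP k i; first by rewrite dvdp_mulr // mi.
rewrite dvdp_mull // mj // ltn_subLR; last by rewrite -ltnS.
rewrite ltn_add2r ltn_neqAle leik andbT; apply/negP=> /eqP eki; apply: nk.
exact/eqP/val_inj.
Qed.

(* Gauss's lemma: remove the irreducible factors of [a] one at a time. *)
Lemma lead_coef_content {R : fieldType} {a : {poly R}} {Q S P : {poly {poly R}}} :
  a != 0 -> P \is monic -> Q * S = a *: P -> content_dvd (lead_coef Q) Q.
Proof.
have [n] := ubnP (size a); elim: n => // n IH in a Q S *; rewrite ltnS => sa a0 Pm E.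
have lcE : lead_coef Q * lead_coef S = a.
  by rewrite -lead_coefM E lead_coefZ (monicP Pm) mulr1.
(* When [a] is a scalar, [lead_coef Q] divides a unit and hence everything. *)
have [a1|a1] := leqP (size a) 1.
  have ua : a %| 1.
    by rewrite dvdp1 eqn_leq a1 size_poly_gt0.
  by move=> i; apply: dvdp_trans (dvd1p _); apply: dvdp_trans ua; rewrite -lcE dvdp_mulr.
have [p irr pa] := exists_irredp _ a a1.
have p0 := irredp_neq0 irr; have [a1' aE] := dvdpP _ _ pa.
have a1n0 : a1' != 0 by apply: contraNneq a0 => a10; rewrite aE a10 mul0r.
have sa1 : (size a1' < n)%N.
  apply: leq_trans sa; rewrite aE size_mul //; case: irr => p1 _.
  move: a1n0; rewrite -size_poly_gt0; move: p1; move: (size a1') (size p); lia.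
have pQS : content_dvd p (Q * S).
  by move=> i; rewrite E coefZ dvdp_mulr.
have Zinj : injective ( *:%R p : {poly {poly R}} -> _).
  move=> x y /eqP; rewrite -!mul_polyC -subr_eq0 -mulrBr mulf_eq0 polyC_eq0 (negPf p0).
  by rewrite subr_eq0 => /eqP.
have [/content_dvdP[Q1 QE]|/content_dvdP[S1 SE]] := irredp_content_dvdM irr pQS.
  have H : content_dvd (lead_coef Q1) Q1.
    apply: (IH a1' Q1 S) => //; apply: Zinj.
    by rewrite scalerAl -QE E scalerA mulrC -aE.
  by move=> i; rewrite QE lead_coefZ coefZ dvdp_mul2l ?H.
apply: (IH a1' Q S1) => //; apply: Zinj.
by rewrite scalerAr -SE E scalerA mulrC -aE.
Qed.

(** * The algebra [k[f]] and saturated subalgebras *)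

Lemma in_kfC {R : fieldType} (f : {poly R}) (a : R) : in_kf f a%:P.
Proof. by exists a%:P; rewrite comp_polyC. Qed.

Lemma in_kf_id {R : fieldType} (f : {poly R}) : in_kf f f.
Proof. by exists 'X; rewrite comp_polyX. Qed.

Lemma in_kfD {R : fieldType} {f x y : {poly R}} :
  in_kf f x -> in_kf f y -> in_kf f (x + y).
Proof. by move=> [p ->] [q ->]; exists (p + q); rewrite comp_polyD. Qed.

Lemma in_kfM {R : fieldType} {f x y : {poly R}} :
  in_kf f x -> in_kf f y -> in_kf f (x * y).
Proof. by move=> [p ->] [q ->]; exists (p * q); rewrite comp_polyM. Qed.

Lemma in_kfZ {R : fieldType} {f x : {poly R}} a : in_kf f x -> in_kf f (a *: x).
Proof. by move=> [p ->]; exists (a *: p); rewrite comp_polyZ. Qed.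

(** Repeated division by [f] shows that the powers of ['X] below the degree of [f] span [k[t]] over
    [k[f]]. *)
Lemma in_kf_base_expansion {R : fieldType} (f h : {poly R}) : (1 < size f)%N ->
  exists Q : {poly {poly R}},
    [/\ forall i, in_kf f Q`_i, (size Q < size f)%N & Q.['X] = h].
Proof.
move=> f1; have f0 : f != 0 by rewrite -size_poly_gt0 ltnW.
have [n] := ubnP (size h); elim: n => // n IH in h *; rewrite ltnS => sh.
have [hf|fh] := ltnP (size h) (size f).
  exists h^:P; split; last by rewrite -/(h \Po 'X) comp_polyXr.
    by move=> i; rewrite coef_map; apply: in_kfC.
  by rewrite size_map_polyC.
have [|Q [Qf sQ QX]] := IH (h %/ f).
  by apply: leq_trans sh; rewrite size_divp //; move: f1 fh; move: (size f) (size h); lia.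
exists (f *: Q + (h %% f)^:P); split.
- move=> i; rewrite coefD coefZ coef_map; apply: in_kfD; last exact: in_kfC.
  by apply: in_kfM; first exact: in_kf_id.
- apply: leq_ltn_trans (size_polyD _ _) _; rewrite gtn_max size_map_polyC ltn_modp f0 andbT.
  exact: leq_ltn_trans (size_scale_leq _ _) sQ.
by rewrite hornerD hornerZ QX -/(_ \Po _) comp_polyXr mulrC -divp_eq.
Qed.

(** The field [ss_div] makes [C] the intersection of its fraction field with [k[t]]; it excludes
    algebras such as [k[t^2, t^3]], which are not of the form [k[f]]. *)
Record saturated_subalg {R : fieldType} (C : {poly R} -> Prop) := SaturatedSubalg {
  ssC : forall a, C a%:P;
  ssD : forall x y, C x -> C y -> C (x + y);
  ssM : forall x y, C x -> C y -> C (x * y);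
  ss_div : forall x y, x != 0 -> C x -> C (x * y) -> C y }.

(** * Lueroth's theorem for polynomials *)

Section PolynomialLuroth.
Context {R : fieldType} (C : {poly R} -> Prop) (hC : saturated_subalg C).

(* In [{poly {poly R}}] the outer variable is [x] and the inner one is [t], so
   that [Q.['X]] is [Q(t, t)]. *)
Definition annih (Q : {poly {poly R}}) := (forall i, C Q`_i) /\ Q.['X] = 0.

(** With denominators cleared, this is the minimal polynomial of [t] over the fraction field of
    [C]. *)
Definition min_annih (Q : {poly {poly R}}) :=
  [/\ annih Q, Q != 0 & forall Q', annih Q' -> Q' != 0 -> (size Q <= size Q')%N].

Let CB x y : C x -> C y -> C (x - y).
Proof.
move=> Cx Cy; apply: (ssD _ hC) => //; rewrite -mulN1r; apply: (ssM _ hC) => //.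
by rewrite -polyCN; apply: (ssC _ hC).
Qed.

Lemma annih_diff c : C c -> annih (c^:P - c%:P).
Proof.
move=> Cc; split; last by rewrite hornerD hornerN hornerC -/(c \Po 'X) comp_polyXr subrr.
move=> i; rewrite coefB coef_map coefC; apply: CB; first exact: (ssC _ hC).
by case: eqP => // _; apply: (ssC _ hC).
Qed.

Lemma size_diff (c : {poly R}) : (1 < size c)%N -> size (c^:P - c%:P) = size c.
Proof.
move=> c1; rewrite size_polyDl size_map_polyC // size_polyN.
by apply: leq_ltn_trans c1; apply: size_polyC_leq1.
Qed.

Lemma lead_coef_diff (c : {poly R}) :
  (1 < size c)%N -> lead_coef (c^:P - c%:P) = (lead_coef c)%:P.
Proof.
move=> c1; rewrite lead_coefDl ?lead_coef_map_inj //; first exact: polyC_inj.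
by rewrite size_polyN size_map_polyC; apply: leq_ltn_trans c1; apply: size_polyC_leq1.
Qed.

(** Pseudo-division by [Q] keeps the coefficients in [C] and the value at ['X] zero, so by
    minimality of [Q] the last remainder is zero. *)
Lemma min_annih_dvd {Q P} : min_annih Q -> annih P ->
  exists k S, lead_coef Q ^+ k *: P = Q * S.
Proof.
move=> [[CQ Q0] nQ minQ].
have [n] := ubnP (size P); elim: n => // n IH in P *; rewrite ltnS => sP [CP P0].
have [->|nP] := eqVneq P 0; first by exists 0%N, 0; rewrite scaler0 mulr0.
have leQP := minQ P (conj CP P0) nP.
pose T := lead_coef P *: 'X^(size P - size Q) : {poly {poly R}}.
pose P1 := lead_coef Q *: P - T * Q.
have nlP : lead_coef P != 0 by rewrite lead_coef_eq0.
have nlQ : lead_coef Q != 0 by rewrite lead_coef_eq0.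
have TQ i : (T * Q)`_i = lead_coef P * ('X^(size P - size Q) * Q)`_i.
  by rewrite /T -scalerAl coefZ.
have [||k [S E]] := IH P1; last first.
- exists k.+1, (S + lead_coef Q ^+ k *: T).
  have -> : lead_coef Q ^+ k.+1 *: P = lead_coef Q ^+ k *: P1 + lead_coef Q ^+ k *: (T * Q).
    by rewrite -scalerDr subrK exprSr scalerA.
  by rewrite E mulrDr -scalerAr (mulrC Q T).
- split; last by rewrite hornerD hornerN hornerZ P0 hornerM Q0 !mulr0 subr0.
  move=> i; rewrite coefB coefZ TQ coefXnM; apply: CB; apply: (ssM _ hC) => //;
    try exact: CQ; try exact: CP.
  by case: ifP => // _; apply: (ssC _ hC).
apply: leq_trans sP; rewrite (polySpred nP) ltnS; apply/leq_sizeP => j.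
rewrite leq_eqVlt => /orP[/eqP <-|ltj].
  rewrite coefB coefZ TQ coefXnM; have sQ : (0 < size Q)%N by rewrite size_poly_gt0.
  have -> : ((size P).-1 < size P - size Q)%N = false.
    by apply/negbTE; move: sQ leQP; lia.
  have -> : ((size P).-1 - (size P - size Q) = (size Q).-1)%N by move: sQ leQP; lia.
  by rewrite -!lead_coefE mulrC subrr.
have {}ltj : (size P <= j)%N by move: nP ltj; rewrite -size_poly_gt0; lia.
rewrite coefB coefZ TQ coefXnM (leq_sizeP _ _ (leqnn _)) // mulr0.
case: ifP => _; first by rewrite mulr0 subr0.
rewrite [Q`_(_)](leq_sizeP _ _ (leqnn _)) ?mulr0 ?subr0 //.
by move: leQP ltj; lia.
Qed.

(** A minimal [Q] divides a multiple of the monic polynomial [p(x) - p(t)], so Gauss's lemma allows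
    division of [Q] by its leading coefficient; saturation keeps the quotient over [C]. *)
Lemma monic_min_annih : (exists2 p, C p & (1 < size p)%N) ->
  exists2 Q, min_annih Q & Q \is monic.
Proof.
move=> [p0 Cp0 sp0].
have lp0 : lead_coef p0 != 0 by rewrite lead_coef_eq0 -size_poly_gt0 ltnW.
pose p := (lead_coef p0)^-1 *: p0.
have sp : (1 < size p)%N by rewrite size_scale ?invr_eq0.
have Cp : C p by rewrite /p -mul_polyC; apply: (ssM _ hC) => //; apply: (ssC _ hC).
pose P := p^:P - p%:P; have Pm : P \is monic.
  by rewrite monicE /P lead_coef_diff // lead_coefZ mulVf.
have annP := annih_diff p Cp.
pose good n := exists Q, [/\ annih Q, Q != 0 & size Q = n].
have [n [[Q [aQ nQ sQ]] nmin]] : exists n, good n /\ forall m, good m -> (n <= m)%N.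
  by apply: prop_min_nat; exists (size P), P; split=> //; apply: monic_neq0.
have mQ : min_annih Q by split=> // Q' aQ' nQ'; rewrite sQ; apply: nmin; exists Q'.
have nlQ : lead_coef Q != 0 by rewrite lead_coef_eq0.
have [k [S E]] := min_annih_dvd mQ annP.
have [Q1 QE] := content_dvdP _ _ (lead_coef_content (expf_neq0 k nlQ) Pm (esym E)).
have Q1m : Q1 \is monic.
  rewrite monicE; apply/eqP; apply: (mulfI nlQ).
  by rewrite mulr1 [in RHS]QE lead_coefZ.
exists Q1 => //; case: aQ => CQ Q0; split; last 1 first.
- move=> Q' aQ' nQ'; have := nmin (size Q') (ex_intro _ Q' (And3 aQ' nQ' erefl)).
  by rewrite -sQ QE size_scale.
- split.
    move=> i; apply: (ss_div _ hC (lead_coef Q)) => //; first exact: CQ.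
    by rewrite -coefZ -QE.
  by apply: (mulfI nlQ); rewrite -hornerZ -QE Q0 mulr0.
- exact: monic_neq0.
Qed.

(* Lueroth's argument: the coefficient [c] of [Q] of largest degree in [t]
   satisfies [Q * S = c(x) - c(t)], and comparing degrees in [t] forces [S] to
   be a scalar. *)
Lemma min_annih_size {Q} : min_annih Q -> Q \is monic ->
  exists2 c, C c & (1 < size c)%N /\ size Q = size c.
Proof.
move=> mQ Qm; have [[CQ Q0] nQ _] := mQ.
have [i si] : exists i, size Q`_i = sizeY Q.
  have Q_gt0 : (0 < #|'I_(size Q)|)%N by rewrite card_ord size_poly_gt0.
  rewrite /sizeY; have [i ->] := eq_bigmax (fun i : 'I_(size Q) => size Q`_i) Q_gt0.
  by exists i.
(* Otherwise [Q] does not involve [t], and [Q(t, t) = 0] forces [Q = 0]. *)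
have sY : (1 < sizeY Q)%N.
  rewrite ltnNge; apply/negP=> sY.
  have QE : Q = (\poly_(j < size Q) (Q`_j)`_0)^:P.
    apply/polyP=> j; rewrite coef_map coef_poly; case: ltnP => [_|/leq_sizeP-> //].
    by apply: size1_polyC; apply: leq_trans (max_size_coefXY _ _) sY.
  move: Q0; rewrite QE -/(_ \Po 'X) comp_polyXr => E.
  by move: nQ; rewrite QE E map_poly0 eqxx.
pose c := Q`_i; have c1 : (1 < size c)%N by rewrite /c si.
exists c; [exact: CQ | split=> //].
have [k [S]] := min_annih_dvd mQ (annih_diff c (CQ i)).
rewrite (monicP Qm) expr1n scale1r => E.
have E' : swapXY Q * swapXY S = c%:P - c^:P.
  by rewrite -rmorphM -E rmorphB /= swapXY_polyC swapXY_map_polyC.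
have E'' : swapXY Q * - swapXY S = c^:P - c%:P by rewrite mulrN E' opprB.
have nS : S != 0.
  apply/eqP=> S0; move: (size_diff c c1); rewrite E S0 mulr0 size_poly0 => c0.
  by rewrite -c0 in c1.
(* After swapping the variables [size] measures the degree in [t], which is that of [c] both for [Q]
   and for the product. *)
have sS : (size (swapXY S) <= 1)%N.
  have := congr1 (fun u : {poly {poly R}} => size u) E''.
  rewrite size_mul ?oppr_eq0 ?swapXY_eq0 // size_polyN size_diff //.
  have -> : size (swapXY Q) = size c by rewrite -sizeYE -si.
  by move: c1; move: (size c) (size (swapXY S)); lia.
(* The leading coefficient in [t] of [c(x) - c(t)] is a scalar, so that of [S], a polynomial in [x],
   divides a scalar. *)
have lS : lead_coef (swapXY Q) * - lead_coef (swapXY S) = (lead_coef c)%:P.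
  by rewrite -lead_coefN -lead_coefM E'' lead_coef_diff.
have lc0 : lead_coef c != 0 by rewrite lead_coef_eq0 -size_poly_gt0 ltnW.
have : size (lead_coef (swapXY S)) = 1%N.
  apply/eqP; rewrite -dvdp1.
  apply: (@dvdp_trans _ (lead_coef c)%:P).
    by rewrite -lS dvdp_mull // -mulN1r dvdp_mull.
  by rewrite dvdp1 size_polyC lc0.
move/eqP/size_poly1P=> [s s0 lsE].
have SE : S = s%:P%:P.
  apply: (can_inj swapXYK); rewrite swapXY_polyC map_polyC /= -lsE.
  rewrite [LHS](size1_polyC sS) /lead_coef; congr (_%:P); congr (_`_ _).
  by case: (size _) sS => [|[]].
by rewrite -(size_diff c c1) E SE mulrC mul_polyC size_scale // polyC_eq0.
Qed.

(** Take for [f] the normalised [c] of the previous lemma. For [h] in [C] with base-[f] expansion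
    [T], the difference [T - h%:P] is an annihilator shorter than [Q], hence zero, and [h] is the
    constant coefficient of [T]. *)
Lemma polynomial_Luroth : (exists2 p, C p & (1 < size p)%N) ->
  exists f : {poly R},
    [/\ (1 < size f)%N, f \is monic, f.[0] = 0 & forall h, C h <-> in_kf f h].
Proof.
move=> exp; have [Q mQ Qm] := monic_min_annih exp.
have [c Cc [c1 sQ]] := min_annih_size mQ Qm.
have lc0 : lead_coef c != 0 by rewrite lead_coef_eq0 -size_poly_gt0 ltnW.
pose c' := c - (c.[0])%:P; pose f := (lead_coef c)^-1 *: c'.
have sc : (size (- (c.[0])%:P) < size c)%N.
  by rewrite size_polyN; apply: leq_ltn_trans c1; apply: size_polyC_leq1.
have sf : size f = size c by rewrite size_scale ?invr_eq0 // size_polyDl.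
have Cf : C f.
  by rewrite /f -mul_polyC; apply: (ssM _ hC); [|apply: CB => //]; apply: (ssC _ hC).
exists f; split=> [|||h].
- by rewrite sf.
- by rewrite monicE lead_coefZ lead_coefDl // mulVf.
- by rewrite /f hornerZ !hornerE subrr mulr0.
have kfC x : in_kf f x -> C x.
  move=> [p ->]; rewrite comp_polyE; elim/big_ind: _ => [|y z Cy Cz|i _].
  - by rewrite -polyC0; apply: (ssC _ hC).
  - exact: (ssD _ hC).
  rewrite -mul_polyC; apply: (ssM _ hC); first exact: (ssC _ hC).
  elim: (val i) => [|n IH]; first by rewrite expr0; apply: (ssC _ hC).
  by rewrite exprS; apply: (ssM _ hC).
split=> [Ch|]; last exact: kfC.
have [|T [kT sT TX]] := in_kf_base_expansion f h; first by rewrite sf.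
have T0 : T - h%:P = 0.
  apply/eqP; apply: contraT => nT; case: mQ => _ _ /(_ (T - h%:P) _ nT) H.
  suff: (size f <= size (T - h%:P)%R)%N.
    rewrite leqNgt => /negP[]; apply: leq_ltn_trans (size_polyD _ _) _.
    rewrite gtn_max sT size_polyN sf.
    by apply: leq_ltn_trans c1; apply: size_polyC_leq1.
  rewrite sf -sQ; apply: H.
  split; last by rewrite hornerD hornerN TX hornerC subrr.
  move=> i; rewrite coefB coefC; apply: CB; first exact: kfC.
  by case: eqP => // _; apply: (ssC _ hC).
have := kT 0%N; have /eqP := T0; rewrite subr_eq0 => /eqP ->.
by rewrite coefC.
Qed.

End PolynomialLuroth.

(** * Degrees under the bracket and linear dependence *)

Lemma coefM_top {R : nzRingType} (p q : {poly R}) a b :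
  (size p <= a.+1)%N -> (size q <= b.+1)%N -> (p * q)`_(a + b) = p`_a * q`_b.
Proof.
move=> sp sq; rewrite coefM; have lta : (a < (a + b).+1)%N by rewrite ltnS leq_addr.
rewrite (bigD1 (Ordinal lta)) //= addKn big1 ?addr0 // => i /negP ni.
have [ltai|] := ltnP a i; first by rewrite (leq_sizeP _ _ sp) // mul0r.
rewrite leq_eqVlt => /orP[/eqP eia|ltia]; first by case: ni; apply/eqP/val_inj.
by rewrite (leq_sizeP _ _ sq) ?mulr0 // ltn_subRL addnC; lia.
Qed.

Lemma size_wbr {R : fieldType} (x y : {poly R}) : [pchar R] =i pred0 ->
  (0 < size x)%N -> (size x < size y)%N ->
  (size (wbr x y)).+2 = (size x + size y)%N.
Proof.
move=> ch x0 xy; have y0 : (0 < size y)%N by apply: leq_trans xy.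
pose a := (size x).-1; pose b := (size y).-1.
have sx : size x = a.+1 by rewrite prednK.
have sy : size y = b.+1 by rewrite prednK.
have XD (z : {poly R}) i : ('X * z^`())`_i = z`_i *+ i.
  by rewrite coefXM coef_deriv; case: i.
have sXD (z : {poly R}) : (size ('X * z^`())%R <= size z)%N.
  by apply/leq_sizeP=> j sj; rewrite XD (leq_sizeP _ _ sj) ?mul0rn.
have E : 'X * wbr x y = x * ('X * y^`()) - ('X * x^`()) * y.
  by rewrite /wbr; ring.
have top : ('X * wbr x y)`_(a + b) != 0.
  rewrite E coefB !coefM_top -?sx -?sy // !XD.
  have -> : x`_a = lead_coef x by [].
  have -> : y`_b = lead_coef y by [].
  rewrite -(mulr_natr _ b) -(mulr_natr _ a).
  have -> : lead_coef x * (lead_coef y * b%:R) - lead_coef x * a%:R * lead_coef y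
     = lead_coef x * lead_coef y * (b - a)%:R.
    by rewrite natrB; [ring | move: xy; rewrite sx sy; lia].
  rewrite !mulf_neq0 ?lead_coef_eq0 -?size_poly_gt0 //.
  by move/pcharf0P: ch => ->; move: xy; rewrite sx sy; lia.
have nW : wbr x y != 0 by apply: contraNneq top => ->; rewrite mulr0 coef0.
have s1 : size ('X * wbr x y) = (size (wbr x y)).+1 by rewrite mulrC size_mulX.
have : (size ('X * wbr x y)%R <= (a + b).+1)%N.
  rewrite E; apply: leq_trans (size_polyD _ _) _; rewrite size_polyN geq_max.
  apply/andP; split; apply: leq_trans (size_polyMleq _ _) _.
    by have := sXD y; rewrite sx sy; move: (size ('X * _)); lia.
  by have := sXD x; rewrite sx sy; move: (size ('X * _)); lia.
have : (a + b < size ('X * wbr x y)%R)%N.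
  by rewrite ltnNge; apply: contraNN top => /leq_sizeP->.
by rewrite s1 sx sy; lia.
Qed.

Lemma not_fin_dim_size {R : fieldType} (L : {poly R} -> Prop) n :
  ~ fin_dim L -> exists2 x, L x & (n < size x)%N.
Proof.
move=> infL; apply: NNPP => H; apply: infL.
exists (mkseq (fun i => 'X^i) n) => v Lv.
have sv : (size v <= n)%N by rewrite leqNgt; apply/negP=> ?; apply: H; exists v.
exists (fun i => v`_i); have ss : size (mkseq (fun i => 'X^i : {poly R}) n) = n.
  by rewrite size_mkseq.
rewrite (eq_bigr (fun i : 'I_(size (mkseq (fun i => 'X^i : {poly R}) n)) =>
    v`_i *: 'X^i)); last first.
  by move=> i _; rewrite nth_mkseq //; case: i => i /=; rewrite ss.
rewrite ss -poly_def; apply/polyP=> i; rewrite coef_poly.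
by case: ltnP => // ni; rewrite (leq_sizeP _ _ sv).
Qed.

Lemma free_of_sizes {R : fieldType} {N : nat} (w : 'I_N -> {poly R}) (c : 'I_N -> R) :
  injective (fun i => size (w i)) -> (forall i, w i != 0) ->
  \sum_i c i *: w i = 0 -> forall i, c i = 0.
Proof.
move=> winj w0 S0 i; apply/eqP; apply: contraT => ci.
have [k ck kmax] := @arg_maxnP _ i (fun j => c j != 0) (fun j => size (w j)) ci.
have /eqP := congr1 (fun p : {poly R} => p`_(size (w k)).-1) S0.
rewrite coef_sum coef0 (bigD1 k) //= coefZ big1 ?addr0 => [|j jk].
  by rewrite mulf_eq0 (negPf ck) -/(lead_coef _) lead_coef_eq0 (negPf (w0 k)).
rewrite coefZ; have [->|cj] := eqVneq (c j) 0; first by rewrite mul0r.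
have := kmax j cj; rewrite /= leq_eqVlt => /orP[/eqP/winj e|lt].
  by rewrite e eqxx in jk.
by rewrite (leq_sizeP _ _ (leqnn _)) ?mulr0 //; move: lt; move: (size _) (size _); lia.
Qed.

Lemma exists_dependency {R : fieldType} {T U : finType} (v : T -> U -> R) :
  (#|U| < #|T|)%N ->
  exists2 c : T -> R, exists t, c t != 0 & forall u, \sum_t c t * v t u = 0.
Proof.
move=> UT; pose A := \matrix_(i < #|T|, j < #|U|) v (enum_val i) (enum_val j).
have /rowV0Pn[r /sub_kermxP rA r0] : kermx A != 0.
  rewrite -mxrank_eq0 mxrank_ker -lt0n subn_gt0.
  exact: leq_ltn_trans (rank_leq_col A) UT.
exists (fun t => r 0 (enum_rank t)).
  apply: NNPP => H; move/negP: r0; apply; apply/eqP/rowP=> i; rewrite mxE.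
  apply/eqP/negbNE/negP=> ri; apply: H; exists (enum_val i).
  by rewrite enum_valK.
move=> u; have /rowP/(_ (enum_rank u)) := rA; rewrite !mxE => E; rewrite -[RHS]E.
rewrite [RHS](reindex (@enum_rank T)) /=; last exact: onW_bij (enum_rank_bij T).
by apply: eq_bigr => t _; rewrite mxE !enum_rankK.
Qed.

(** * Jets along the diagonal *)

Section DiagonalJets.
Context {R : fieldType} {N : nat} (b : 'I_N -> {poly R}).

(* [jet r a] is the value on the diagonal of the [r]-th [x]-derivative of
   [\sum_j a_j(x) b_j(y)]; [jets_vanish k a] says that this polynomial is
   divisible by [(x - y)^k]. *)
Definition jet r (a : 'I_N -> {poly R}) := \sum_j (a j)^`(r) * b j.

Definition jets_vanish k a := forall r, (r < k)%N -> jet r a = 0.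

Lemma jetS r a : jet r.+1 a = jet r (fun j => (a j)^`()).
Proof. by apply: eq_bigr => j _; rewrite derivSn. Qed.

Lemma jetD r a a' : jet r (fun j => a j + a' j) = jet r a + jet r a'.
Proof. by rewrite -big_split; apply: eq_bigr => j _ /=; rewrite derivnD mulrDl. Qed.

Lemma jetB r a a' : jet r (fun j => a j - a' j) = jet r a - jet r a'.
Proof. by rewrite -sumrB; apply: eq_bigr => j _ /=; rewrite derivnB mulrBl. Qed.

Lemma eq_jet r a a' : a =1 a' -> jet r a = jet r a'.
Proof. by move=> e; apply: eq_bigr => j _; rewrite e. Qed.

(** In Leibniz's formula every term that differentiates [c] contains a jet of lower order, which
    vanishes. *)
Lemma jet_mul k c a : jets_vanish k a ->
  jets_vanish k (fun j => c * a j) /\ jet k (fun j => c * a j) = c * jet k a.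
Proof.
elim: k => [|k IH] in c a * => Va.
  by split=> //; rewrite /jet mulr_sumr; apply: eq_bigr => j _; rewrite !derivn0 mulrA.
have Va0 : jets_vanish k a by move=> r rk; apply: Va; apply: ltnW.
have Va1 : jets_vanish k (fun j => (a j)^`()) by move=> r rk; rewrite -jetS; apply: Va.
have jS r : jet r.+1 (fun j => c * a j) =
    jet r (fun j => c^`() * a j) + jet r (fun j => c * (a j)^`()).
  by rewrite jetS -jetD; apply: eq_jet => j; rewrite derivM.
split.
  case=> [|r] rk; last by rewrite jS (IH _ _ Va0).1 // (IH _ _ Va1).1 // addr0.
  transitivity (c * jet 0 a); last by rewrite Va // mulr0.
  by rewrite /jet mulr_sumr; apply: eq_bigr => j _; rewrite !derivn0 mulrA.
by rewrite jS (IH _ _ Va0).2 (IH _ _ Va1).2 (Va k) // mulr0 add0r -jetS.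
Qed.

(** In [c * a_j' - c' * a_j] the derivative lowers the order of vanishing by one, while the second
    term keeps it. *)
Lemma jet_wbr {k} c {a} : jets_vanish k.+1 a ->
  jets_vanish k (fun j => wbr c (a j)) /\
  jet k (fun j => wbr c (a j)) = c * jet k.+1 a.
Proof.
move=> Va.
have Va1 : jets_vanish k (fun j => (a j)^`()) by move=> r rk; rewrite -jetS; apply: Va.
have [V1 J1] := jet_mul _ c _ Va1; have [V2 _] := jet_mul _ c^`() _ Va.
split=> [r rk|]; first by rewrite jetB V1 // V2 ?subr0 // ltnW.
by rewrite jetB J1 V2 // subr0 -jetS.
Qed.

(** The vanishing jets kill the coefficients of [c''] and [c']; differentiating the relations they
    give expresses the coefficient of [c] through the second jet. *)
Lemma sum_wbr_wbr a c : jets_vanish 2 a ->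
  \sum_j wbr (a j) (wbr (b j) c) = - (jet 2 a *+ 2) * c.
Proof.
move=> Va.
have J0 : \sum_j a j * b j = 0.
  by rewrite -[RHS](Va 0%N) //; apply: eq_bigr => j _; rewrite derivn0.
have J1 : \sum_j (a j)^`() * b j = 0.
  by rewrite -[RHS](Va 1%N) //; apply: eq_bigr => j _; rewrite derivn1.
have J0' : \sum_j a j * (b j)^`() = 0.
  have := congr1 (@deriv R) J0; rewrite deriv0 linear_sum /=.
  under eq_bigr do rewrite derivM.
  by rewrite big_split /= J1 add0r.
have J2 : \sum_j (a j)^`() * (b j)^`() = - jet 2 a.
  have := congr1 (@deriv R) J1; rewrite deriv0 linear_sum /=.
  under eq_bigr do rewrite derivM.
  rewrite big_split /= => /eqP; rewrite addrC addr_eq0 => /eqP ->.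
  by congr (- _); apply: eq_bigr => j _; rewrite derivnS derivn1.
have J2' : \sum_j a j * (b j)^`()^`() = jet 2 a.
  have := congr1 (@deriv R) J0'; rewrite deriv0 linear_sum /=.
  under eq_bigr do rewrite derivM.
  by rewrite big_split /= J2 addrC => /eqP; rewrite subr_eq0 => /eqP.
have -> : \sum_j wbr (a j) (wbr (b j) c) =
   (\sum_j a j * b j) * c^`()^`() - (\sum_j (a j)^`() * b j) * c^`()
   + (\sum_j (a j)^`() * (b j)^`() - \sum_j a j * (b j)^`()^`()) * c.
  rewrite -sumrB !mulr_suml -sumrB -big_split /=; apply: eq_bigr => j _.
  by rewrite /wbr derivB !derivM; ring.
by rewrite J0 J1 J2 J2'; ring.
Qed.

End DiagonalJets.

(** * Existence of a nonconstant multiplier *)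

Lemma lie_subalg_sum {R : fieldType} {L : {poly R} -> Prop} {I : Type} (r : seq I)
    (F : I -> {poly R}) :
  lie_subalg L -> (forall i, L (F i)) -> L (\sum_(i <- r) F i).
Proof. by move=> [L0 LD _ _] LF; elim/big_ind: _ => // i _. Qed.

Lemma derivn_size_neq0 {R : fieldType} (p : {poly R}) :
  [pchar R] =i pred0 -> p != 0 -> p^`((size p).-1)`_0 != 0.
Proof.
move=> ch p0; rewrite coef_derivn addn0 -/(lead_coef p) -mulr_natr mulf_neq0 ?lead_coef_eq0 //.
by move/pcharf0P: ch => ->; rewrite ffactnn -lt0n fact_gt0.
Qed.

Definition multiplier {R : fieldType} (L : {poly R} -> Prop) (p : {poly R}) :=
  forall x, L x -> L (p * x).

(* Bracketing the [x]-variable with [c] lowers by one the order of vanishing on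
   the diagonal; at order two the operator [\sum_j ad a_j ad b_j] is a
   multiplication. *)
Lemma multiplier_of_jets {R : fieldType} {L : {poly R} -> Prop} {N}
    (a b : 'I_N -> {poly R}) c m : [pchar R] =i pred0 -> lie_subalg L ->
  (forall j, L (a j)) -> (forall j, L (b j)) -> L c -> (1 < size c)%N ->
  jets_vanish b m.+3 a -> jet b m.+3 a != 0 ->
  exists2 p, multiplier L p & (1 < size p)%N.
Proof.
move=> ch hL La Lb Lc c1; have [L0 LD LZ LW] := hL.
have c0 : c != 0 by rewrite -size_poly_gt0 ltnW.
elim: m => [|m IH] in a La * => Va na; have [V J] := jet_wbr b c Va; last first.
  by apply: (IH (fun j => wbr c (a j))) => // [j|]; [exact: LW | rewrite J mulf_neq0].
(* Even at order three one bracket with [c] is taken: the second jet then equals [c * jet b 3 a],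
   which is nonconstant because [c] is. *)
exists (- (jet b 2 (fun j => wbr c (a j)) *+ 2)).
  move=> x Lx; rewrite -sum_wbr_wbr //; apply: lie_subalg_sum => // j.
  by apply: (LW); exact: (LW).
have two0 : 2%:R != 0 :> R by move/pcharf0P: ch => ->.
rewrite size_polyN -scaler_nat size_scale // J size_mul //.
by move: na c1; rewrite -size_poly_gt0; move: (size _) (size _); lia.
Qed.

Lemma exists_multiplier {R : fieldType} {L : {poly R} -> Prop} :
  [pchar R] =i pred0 -> lie_subalg L -> ~ fin_dim L ->
  exists2 p, multiplier L p & (1 < size p)%N.
Proof.
move=> ch hL infL; have [L0 LD LZ LW] := hL.
have [u Lu su] := not_fin_dim_size L 2 infL.
have [v Lv sv] := not_fin_dim_size L (size u) infL.
(* As [1 < deg u < deg v], each bracket with [u] raises the degree by [deg u - 1 > 0], so the sizes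
   form a strictly increasing arithmetic progression. *)
pose w i := iter i (wbr u) v; pose m := (size u).-2.
have Lw i : L (w i) by elim: i => // i IH; apply: LW.
have sw i : size (w i) = (size v + i * m)%N.
  elim: i => [|i IH]; first by rewrite addn0.
  have := @size_wbr R u (w i) ch (ltnW (ltnW su)).
  rewrite IH -/(w i.+1) => /(_ (leq_trans sv (leq_addr _ _))).
  by rewrite /m; move: su sv; move: (size (w i.+1)) (size u) (size v); nia.
(* The unknowns are the [N ^ 2] coefficients of the products [w_i(x) w_j(y)]. The equations kill the
   first three jets, each of size at most [D]; their number [3 * D] grows only linearly in [N], and
   this [N] exceeds the break-even point. *)
pose N := (6 * size v + 6 * m).+1; pose D := (2 * (size v + N * m))%N.
pose b (j : 'I_N) := w j.
have [|cf [[i0 j0] /= c0] cP] := @exists_dependency R ('I_N * 'I_N)%type ('I_3 * 'I_D)%type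
    (fun ij re => ((w ij.1)^`(re.1) * w ij.2)`_re.2).
  by rewrite !card_prod !card_ord /D /N; nia.
pose a (j : 'I_N) := \sum_(i < N) cf (i, j) *: w i.
have La j : L (a j) by apply: lie_subalg_sum => // i; apply: LZ.
have jE r : jet b r a = \sum_ij cf ij *: ((w ij.1)^`(r) * w ij.2).
  transitivity (\sum_(i < N) \sum_(j < N) cf (i, j) *: ((w i)^`(r) * w j)); last first.
    by rewrite pair_bigA /=; apply: eq_bigr => -[].
  rewrite exchange_big /=.
  apply: eq_bigr => j _; rewrite linear_sum mulr_suml /=; apply: eq_bigr => i _.
  by rewrite derivnZ scalerAl.
have V3 : jets_vanish b 3 a.
  move=> r r3; rewrite jE; apply/polyP=> e; rewrite coef_sum coef0.
  under eq_bigr do rewrite coefZ.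
  have [eD|De] := ltnP e D; first exact: (cP (Ordinal r3, Ordinal eD)).
  apply: big1 => -[i j] _ /=; rewrite (leq_sizeP _ _ (leqnn _)) ?mulr0 //.
  apply: leq_trans De; apply: leq_trans (size_polyMleq _ _) _.
  have sd : (size ((w i)^`(r))%R <= size (w i))%N.
    apply/leq_sizeP=> k sk; rewrite coef_derivn (leq_sizeP _ _ (leqnn _)) ?mul0rn //.
    exact: leq_trans sk (leq_addl _ _).
  have := ltn_ord i; have := ltn_ord j; move: sd; rewrite !sw /D.
  by move: (size _) (size v) => ??; nia.
have winj : injective (fun j : 'I_N => size (b j)).
  move=> i j; rewrite /b !sw => e; apply/val_inj; move: e su; rewrite /= /m.
  by move: (size u) (size v); nia.
have b0 j : b j != 0.
  by rewrite -size_poly_gt0 /b sw; move: sv; move: (size u) (size v); lia.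
(* For [r] the largest degree of the [a j], the [r]-th derivatives are scalars, not all zero, and
   the [b j] are independent. *)
have [r rn] : exists r, jet b r a != 0.
  have [k ak kmax] : exists2 k, a k != 0 & forall j, (size (a j) <= size (a k))%N.
    have aj0 : a j0 != 0.
      apply: contraNneq c0 => a0; apply/eqP.
      exact: (free_of_sizes b (fun i => cf (i, j0)) winj b0 a0).
    have [k ak kmax] := @arg_maxnP _ j0 (fun j => a j != 0) (fun j => size (a j)) aj0.
    exists k => // j; have [->|/kmax//] := eqVneq (a j) 0; by rewrite size_poly0.
  exists (size (a k)).-1; apply/negP=> /eqP j_0.
  have /free_of_sizes : \sum_j ((a j)^`((size (a k)).-1))`_0 *: b j = 0.
    rewrite -[RHS]j_0; apply: eq_bigr => j _; rewrite -mul_polyC; congr (_ * _).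
    apply/esym/size1_polyC; apply/leq_sizeP => i i1; rewrite coef_derivn.
    rewrite (leq_sizeP _ _ (leqnn _)) ?mul0rn //.
    by have := kmax j; move: ak i1; rewrite -size_poly_gt0; move: (size _) (size _); lia.
  move=> /(_ winj b0 k) /eqP; by rewrite (negPf (derivn_size_neq0 _ ch ak)).
have [k [kn kmin]] := prop_min_nat (fun r => jet b r a != 0) (ex_intro _ r rn).
have Vk : jets_vanish b k a.
  by move=> s sk; apply/eqP; apply: contraLR sk => /kmin; rewrite -leqNgt.
have k3 : (3 <= k)%N by rewrite leqNgt; apply: contraNN kn => /V3->.
case: k k3 => [|[|[|k]]] // _ in kn kmin Vk *.
by apply: (@multiplier_of_jets R L N a b u k) => // [j|]; [exact: Lw | exact: ltnW].
Qed.

(** * The algebra of multipliers and its quotients *)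

Section Multipliers.
Context {R : fieldType} {L : {poly R} -> Prop} (hL : lie_subalg L).

Lemma multiplierC a : multiplier L a%:P.
Proof. by case: hL => _ _ LZ _ x Lx; rewrite mul_polyC; apply: LZ. Qed.

Lemma multiplierD {p q} : multiplier L p -> multiplier L q -> multiplier L (p + q).
Proof. by case: hL => _ LD _ _ Bp Bq x Lx; rewrite mulrDl; apply: LD; auto. Qed.

Lemma multiplierM {p q} : multiplier L p -> multiplier L q -> multiplier L (p * q).
Proof. by move=> Bp Bq x Lx; rewrite -mulrA; apply: Bp; apply: Bq. Qed.

Lemma multiplierB {p q} : multiplier L p -> multiplier L q -> multiplier L (p - q).
Proof.
move=> Bp Bq; apply: multiplierD => //; rewrite -mulN1r -polyCN.
by apply: multiplierM => //; apply: multiplierC.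
Qed.

Lemma multiplierX {p} n : multiplier L p -> multiplier L (p ^+ n).
Proof.
move=> Bp; elim: n => [|n IH]; first by rewrite expr0; apply: multiplierC.
by rewrite exprS; apply: multiplierM.
Qed.

Lemma multiplier_sum (I : Type) (r : seq I) (F : I -> {poly R}) :
  (forall i, multiplier L (F i)) -> multiplier L (\sum_(i <- r) F i).
Proof.
move=> BF; elim/big_ind: _ => // [|x y Bx By]; last exact: multiplierD.
by rewrite -polyC0; apply: multiplierC.
Qed.

Lemma multiplier_comp {p} q : multiplier L p -> multiplier L (q \Po p).
Proof.
move=> Bp; rewrite comp_polyE; apply: multiplier_sum => i; rewrite -mul_polyC.
by apply: multiplierM; [apply: multiplierC | apply: multiplierX].
Qed.

Lemma multiplier_deriv {b x} :
  multiplier L b -> L x -> multiplier L (b^`() * x).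
Proof.
case: (hL) => _ LD LZ LW Bb Lx y Ly.
have -> : b^`() * x * y = wbr x (b * y) + (-1) *: (b * wbr x y).
  by rewrite scaleN1r /wbr derivM; ring.
apply: LD; first by apply: (LW) => //; apply: Bb.
by apply: LZ; apply: (Bb); apply: LW.
Qed.

Definition multiplier_quotient c :=
  exists b, [/\ multiplier L b, b != 0 & multiplier L (b * c)].

Lemma multiplier_quotient_saturated : saturated_subalg multiplier_quotient.
Proof.
split=> [a|x y [b [Bb b0 Bx]] [e [Be e0 By]]|x y [b [Bb b0 Bx]] [e [Be e0 By]]
  |x y x0 [b [Bb b0 Bx]] [e [Be e0 By]]].
- exists 1; rewrite oner_neq0 mul1r; split=> //; exact: multiplierC.
- exists (b * e); split; [exact: multiplierM | exact: mulf_neq0 |].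
  have -> : b * e * (x + y) = e * (b * x) + b * (e * y) by ring.
  by apply: multiplierD; apply: multiplierM.
- exists (b * e); split; [exact: multiplierM | exact: mulf_neq0 |].
  have -> : b * e * (x * y) = (b * x) * (e * y) by ring.
  exact: multiplierM.
- exists (e * (b * x)); split; [exact: multiplierM | by rewrite !mulf_neq0 |].
  have -> : e * (b * x) * y = b * (e * (x * y)) by ring.
  exact: multiplierM.
Qed.

(** This is the quotient rule for [c = (b * c) / b], cleared of the denominator [b * b]. *)
Lemma multiplier_quotient_deriv {c x} :
  multiplier_quotient c -> L x -> multiplier_quotient (c^`() * x).
Proof.
move=> [b [Bb b0 Bc]] Lx; exists (b * b).
split; [exact: multiplierM | exact: mulf_neq0 |].
have -> : b * b * (c^`() * x) = b * ((b * c)^`() * x) - (b^`() * x) * (b * c).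
  by rewrite derivM; ring.
by apply: multiplierB; apply: multiplierM => //; apply: multiplier_deriv.
Qed.

(* With [p = P(f)] a multiplier and [b], [b f] multipliers, [k[f]] is spanned
   over [k[p]] by the [f^i], [i < deg P]; hence [b ^+ size P] is a conductor. *)
Lemma conductor {f p : {poly R}} : (1 < size f)%N -> multiplier_quotient f ->
  multiplier L p -> (1 < size p)%N -> in_kf f p ->
  exists r, [/\ r != 0, multiplier L r & forall q, multiplier L ((q \Po f) * r)].
Proof.
move=> f1 [b [Bb b0 Bf]] Bp p1 [P pE].
have P1 : (1 < size P)%N.
  rewrite ltnNge; apply/negP=> /size1_polyC PE; move: p1.
  rewrite pE PE comp_polyC size_polyC; by case: (_ != 0).
exists (b ^+ size P); split; [exact: expf_neq0 | exact: multiplierX | move=> q].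
have [T [kT sT TX]] := in_kf_base_expansion P q P1.
(* Substituting [f] in the base-[P] expansion of [q] gives terms [t(p) * f ^+ i]; of the factor
   [b ^+ size P], the part [b ^+ i] turns [f ^+ i] into a power of the multiplier [b * f]. *)
rewrite -TX horner_coef linear_sum /= mulr_suml; apply: multiplier_sum => i.
have [t ->] := kT i; rewrite comp_polyM -comp_polyA -pE comp_Xn_poly.
have iP : (i <= size P)%N by apply: leq_trans (ltnW sT); apply: ltnW.
rewrite -(subnK iP) exprD.
have -> : (t \Po p) * f ^+ i * (b ^+ (size P - i) * b ^+ i)
   = (t \Po p) * b ^+ (size P - i) * (b * f) ^+ i by rewrite exprMn; ring.
apply: multiplierM; last exact: multiplierX.
by apply: multiplierM; [exact: multiplier_comp | exact: multiplierX].
Qed.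

End Multipliers.

(** * Division in [k[f]] and the generator of [L(f)] *)

Section SubalgebraOfF.
Context {R : fieldType} {f : {poly R}} (f1 : (1 < size f)%N).

Lemma ltn_size_comp (p q : {poly R}) :
  (size p < size q)%N -> (size (p \Po f) < size (q \Po f))%N.
Proof.
move=> pq; have [->|p0] := eqVneq p 0.
  rewrite comp_poly0 size_poly0 size_poly_gt0 comp_poly_eq0 // -size_poly_gt0.
  exact: leq_ltn_trans pq.
have q0 : q != 0 by rewrite -size_poly_gt0; apply: leq_ltn_trans pq.
rewrite (polySpred (_ : p \Po f != 0)) ?comp_poly_eq0 //.
rewrite (polySpred (_ : q \Po f != 0)) ?comp_poly_eq0 //.
rewrite ltnS !size_comp_poly ltn_mul2r.
move: pq f1 p0; rewrite -size_poly_gt0.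
by move: (size f) (size p) (size q); lia.
Qed.

(** Divide [q] by [p]: the remainder at [f] is a multiple of [x = p(f)] but has smaller size, so it
    vanishes. *)
Lemma in_kf_div x y : x != 0 -> in_kf f x -> in_kf f (x * y) -> in_kf f y.
Proof.
move=> x0 [p px] [q qxy]; exists (q %/ p).
have p0 : p != 0 by apply: contraNneq x0 => p0; rewrite px p0 comp_poly0.
have E : (q %% p) \Po f = x * (y - ((q %/ p) \Po f)).
  rewrite mulrBr qxy px {2}(divp_eq q p) comp_polyD comp_polyM; ring.
apply/eqP; rewrite -subr_eq0; apply: contraT => d0.
have : (size ((q %% p) \Po f) < size (p \Po f))%N.
  by apply: ltn_size_comp; rewrite ltn_modp.
rewrite E -px ltnNge => /negP[]; rewrite size_mul //.
by move: d0; rewrite -size_poly_gt0; move: (size _) (size _); lia.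
Qed.

Lemma is_gf_exists {h : {poly R}} : h != 0 -> in_kf f (f^`() * h) -> exists g, is_gf f g.
Proof.
move=> h0 kh; have lh : lead_coef h != 0 by rewrite lead_coef_eq0.
pose P n := exists g : {poly R}, [/\ g \is monic, in_kf f (f^`() * g) & size g = n].
have [n [[g [gm kg sg]] gmin]] : exists n, P n /\ forall m, P m -> (n <= m)%N.
  apply: prop_min_nat; exists (size h), ((lead_coef h)^-1 *: h); split.
  - by rewrite monicE lead_coefZ mulVf.
  - by rewrite -scalerAr; apply: in_kfZ.
  - by rewrite size_scale ?invr_eq0.
by exists g; split=> // g' g'm kg'; rewrite sg; apply: gmin; exists g'.
Qed.

Hypothesis df0 : f^`() != 0.

(** Writing [f' g = A(f)] and [f' h = H(f)], the remainder of [H] by [A] would yield a polynomial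
    smaller than [g] unless it is zero. Hence [L(f)] is the set of all [h] with [f' h] in [k[f]]. *)
Lemma is_gf_generates {g h} : is_gf f g -> in_kf f (f^`() * h) -> Lfg f g h.
Proof.
move=> [gm [A gA] gmin] [H hH]; exists (H %/ A).
have A0 : A != 0.
  apply/eqP=> A0; move/eqP: gA; rewrite A0 comp_poly0 mulf_eq0 (negPf df0) /=.
  by rewrite (negPf (monic_neq0 gm)).
pose d := h - ((H %/ A) \Po f) * g.
have E : f^`() * d = (H %% A) \Po f.
  have -> : f^`() * d = f^`() * h - ((H %/ A) \Po f) * (f^`() * g) by rewrite /d; ring.
  by rewrite gA hH {1}(divp_eq H A) comp_polyD comp_polyM; ring.
apply/eqP; rewrite -subr_eq0 -/d; apply: contraT => d0.
have ld : (lead_coef d)^-1 != 0 by rewrite invr_eq0 lead_coef_eq0.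
have : (size g <= size ((lead_coef d)^-1 *: d)%R)%N.
  apply: gmin; first by rewrite monicE lead_coefZ mulVf // lead_coef_eq0.
  by rewrite -scalerAr E; apply: in_kfZ; exists (H %% A).
rewrite size_scale // leqNgt => /negP[].
have : (size ((H %% A) \Po f) < size (A \Po f))%N.
  by apply: ltn_size_comp; rewrite ltn_modp.
rewrite -E -gA !size_mul ?(monic_neq0 gm) //.
by move: (size f^`()) (size d) (size g); lia.
Qed.

Lemma Lfg_in_kf {g h} : in_kf f (f^`() * g) -> Lfg f g h -> in_kf f (f^`() * h).
Proof.
move=> kg [p ->]; rewrite mulrCA; apply: in_kfM => //; by exists p.
Qed.

Lemma Lf_in_kf {h} : Lf f h -> in_kf f (f^`() * h).
Proof. by move=> [g [[_ kg _] gh]]; apply: Lfg_in_kf gh. Qed.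

End SubalgebraOfF.

(** * Affine changes of [f] and finite codimension *)

Lemma deriv_neq0 {R : fieldType} {p : {poly R}} :
  [pchar R] =i pred0 -> (1 < size p)%N -> p^`() != 0.
Proof.
move=> ch p1; apply/eqP=> /polyP/(_ (size p).-2); rewrite coef_deriv coef0.
case s : (size p) p1 => [|[|n]] //= _ /eqP.
rewrite -mulr_natr mulf_eq0; move/pcharf0P: ch => ->; rewrite orbF.
have -> : p`_n.+1 = lead_coef p by rewrite lead_coefE s.
by rewrite lead_coef_eq0 -size_poly_eq0 s.
Qed.

(** Degrees multiply under composition, so both composing polynomials have degree one. *)
Lemma in_kf_affine {R : fieldType} {f ft : {poly R}} : (1 < size f)%N ->
  in_kf f ft -> in_kf ft f -> exists a b : R, a != 0 /\ ft = a *: f + b%:P.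
Proof.
move=> f1 [p pE] [q qE].
have /(congr1 predn) := congr1 (fun u : {poly R} => size u) qE.
rewrite size_comp_poly pE size_comp_poly => E.
have p2 : size p = 2.
  have fp : (0 < (size f).-1)%N by move: f1; move: (size f); lia.
  move/eqP: E; rewrite mulnA -[X in X == _]mul1n eqn_pmul2r // eq_sym muln_eq1.
  by case/andP=> _; move: (size p) => [|[|[]]].
exists p`_1, p`_0; split.
  have -> : p`_1 = lead_coef p by rewrite lead_coefE p2.
  by rewrite lead_coef_eq0 -size_poly_eq0 p2.
rewrite comp_polyE p2 !big_ord_recl big_ord0 /= expr0 expr1 addr0 addrC.
by rewrite alg_polyC.
Qed.

Lemma in_kf_affine_eq {R : fieldType} {f : {poly R}} {a b : R} : a != 0 ->
  forall h, in_kf (a *: f + b%:P) h <-> in_kf f h.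
Proof.
move=> a0 h; have E1 : a *: f + b%:P = (a *: 'X + b%:P) \Po f.
  by rewrite comp_polyD comp_polyZ comp_polyX comp_polyC.
have E2 : f = (a^-1 *: ('X - b%:P)) \Po (a *: f + b%:P).
  by rewrite comp_polyZ comp_polyB comp_polyX comp_polyC addrK scalerA mulVf // scale1r.
split=> [[p ->]|[p ->]]; first by rewrite E1 comp_polyA; eexists.
by exists (p \Po (a^-1 *: ('X - b%:P))); rewrite -comp_polyA -E2.
Qed.

Lemma Lfg_in_kfE {R : fieldType} (f g h : {poly R}) :
  Lfg f g h <-> exists2 c, in_kf f c & h = c * g.
Proof.
split=> [[p ->]|[c [p ->] ->]]; last by exists p.
by exists (p \Po f) => //; exists p.
Qed.

(** Dividing [h] by [w] reduces [h(f) * g] modulo [L] to a combination of the [f ^+ i * g] with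
    [i < size w]. *)
Lemma fin_codim_Lfg {R : fieldType} {L : {poly R} -> Prop} {f g w : {poly R}} :
  w != 0 -> psub (Lfg f ((w \Po f) * g)) L -> fin_codim L (Lfg f g).
Proof.
move=> w0 gL; pose s := mkseq (fun i => f ^+ i * g) (size w).
exists s => _ [h ->]; exists (((h %/ w) \Po f) * ((w \Po f) * g)), (((h %% w) \Po f) * g).
split; first by apply: gL; exists (h %/ w).
split; last by rewrite {1}(divp_eq h w) comp_polyD comp_polyM; ring.
have ss : size s = size w by rewrite size_mkseq.
exists (fun i => (h %% w)`_i).
rewrite (eq_bigr (fun i : 'I_(size s) => (h %% w)`_i *: (f ^+ i * g))); last first.
  by move=> i _; rewrite nth_mkseq // -ss.
rewrite ss {1}(_ : h %% w = \poly_(i < size w) (h %% w)`_i); last first.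
  apply/polyP=> i; rewrite coef_poly; case: ltnP => // wi.
  by apply/leq_sizeP: wi; apply: ltnW; rewrite ltn_modp.
rewrite poly_def linear_sum mulr_suml; apply: eq_bigr => i _ /=.
by rewrite comp_polyZ comp_Xn_poly scalerAl.
Qed.

Lemma in_kf_lead_scale {R : fieldType} {f g : {poly R}} :
  in_kf f (f^`() * g) -> in_kf f (f^`() * ((lead_coef g)^-1 *: g)).
Proof. by move=> kg; rewrite -scalerAr; apply: in_kfZ. Qed.

Lemma monic_lead_scale {R : fieldType} {g : {poly R}} :
  g != 0 -> (lead_coef g)^-1 *: g \is monic.
Proof. by move=> g0; rewrite monicE lead_coefZ mulVf // lead_coef_eq0. Qed.

Lemma Lfg_scale {R : fieldType} {L : {poly R} -> Prop} {f g : {poly R}} a :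
  psub (Lfg f g) L -> psub (Lfg f (a *: g)) L.
Proof.
move=> gL _ [p ->]; apply: gL; exists (a *: p).
by rewrite comp_polyZ -scalerAr scalerAl.
Qed.

(** * The inclusions around [L], its codimension in [L(f)], and uniqueness *)

Theorem mainTheorem2 (R : fieldType) (hchar : [pchar R] =i pred0)
  (L : {poly R} -> Prop) :
  lie_subalg L -> ~ fin_dim L ->
  exists f g : {poly R},
    [/\ (1 < size f)%N /\ g != 0, in_kf f (f^`() * g),
        psub (Lfg f g) L /\ psub L (Lf f),
        fin_codim L (Lf f) &
        (* normalisations *)
        [/\ f \is monic, f.[0] = 0, g \is monic &
            forall g' : {poly R}, g' \is monic -> in_kf f (f^`() * g') ->
              psub (Lfg f g') L -> (size g <= size g')%N]] /\
    (* uniqueness *)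
    forall ft gt : {poly R},
      (1 < size ft)%N -> gt != 0 -> in_kf ft (ft^`() * gt) ->
      psub (Lfg ft gt) L -> psub L (Lf ft) ->
      [/\ exists a b : R, a != 0 /\ ft = a *: f + b%:P,
          exists p : {poly R}, gt = (p \Po f) * g,
          (forall h, Lf ft h <-> Lf f h) &
          psub (Lfg ft gt) (Lfg f g)].
Proof.
move=> hL infL; have [p Bp p1] := exists_multiplier hchar hL infL.
have Cp : @multiplier_quotient R L p.
  by exists 1; rewrite oner_neq0 mul1r; split=> //; apply: multiplierC.
have [f [f1 fm f0 kfE]] :=
  polynomial_Luroth _ (multiplier_quotient_saturated hL) (ex_intro2 _ _ p Cp p1).
have df0 := deriv_neq0 hchar f1.
have Cf := (kfE f).2 (in_kf_id f).
have LK x : L x -> in_kf f (f^`() * x).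
  by move=> Lx; apply/kfE; apply: multiplier_quotient_deriv.
have [x0 Lx0 sx0] := not_fin_dim_size L 0 infL.
have x0n : x0 != 0 by rewrite -size_poly_gt0.
have [gf gfP] := is_gf_exists x0n (LK x0 Lx0).
have LfE h : Lf f h <-> in_kf f (f^`() * h).
  split; first exact: Lf_in_kf.
  by move=> kh; exists gf; split=> //; apply: is_gf_generates.
have [r [r0 Br rP]] := conductor hL f1 Cf Bp p1 ((kfE p).1 Cp).
pose good g := [/\ g \is monic, in_kf f (f^`() * g) & psub (Lfg f g) L].
have [g [gm kg gL] gmin] : exists2 g, good g & forall g', good g' -> (size g <= size g')%N.
  have [|n [[g gg sg] gmin]] :=
    @prop_min_nat (fun n => exists2 g : {poly R}, good g & size g = n).
    (* A conductor [r] times any nonzero element of [L] generates inside [L]; scaling makes it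
       monic. *)
    pose g1 := r * x0; exists (size ((lead_coef g1)^-1 *: g1)); eexists; last by [].
    have kg1 : in_kf f (f^`() * g1) by apply: LK; apply: Br.
    split; first by apply: monic_lead_scale; rewrite mulf_neq0.
      exact: in_kf_lead_scale.
    by apply: Lfg_scale => _ [q ->]; rewrite mulrA; apply: rP.
  by exists g => // g' gg'; rewrite sg; apply: gmin; exists g'.
have g0 := monic_neq0 gm.
exists f, g; split.
  split=> //; first by split=> // x Lx; apply/LfE/LK.
    have [w gE] := is_gf_generates f1 df0 gfP kg.
    have w0 : w != 0 by apply: contraNneq g0 => w0; rewrite gE w0 comp_poly0 mul0r.
    have [|s sP] := @fin_codim_Lfg R L f gf w w0; first by rewrite -gE.
    by exists s => v /LfE kv; apply: sP; apply: is_gf_generates.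
  by split=> // g' g'm kg' g'L; apply: gmin.
move=> ft gt ft1 gt0 kgt gtL Lft.
have dft0 := deriv_neq0 hchar ft1.
have Lgt : L gt by apply: gtL; exists 1; rewrite comp_polyC mul1r.
have Lftgt : L (ft * gt) by apply: gtL; exists 'X; rewrite comp_polyX.
have Lg : L g by apply: gL; exists 1; rewrite comp_polyC mul1r.
have Lfg_ : L (f * g) by apply: gL; exists 'X; rewrite comp_polyX.
(* [ft] is the quotient of [f' * ft * gt] by [f' * gt], both in [f' L] and so in [k[f]]; the
   argument for [f] is symmetric. *)
have kft : in_kf f ft.
  apply: (in_kf_div f1 (f^`() * gt)); [by rewrite mulf_neq0 | exact: LK |].
  by rewrite -mulrA (mulrC gt); apply: LK.
have kf : in_kf ft f.
  have K x : L x -> in_kf ft (ft^`() * x) by move=> /Lft /Lf_in_kf.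
  apply: (in_kf_div ft1 (ft^`() * g)); [by rewrite mulf_neq0 | exact: K |].
  by rewrite -mulrA (mulrC g); apply: K.
have [a [b [a0 ftE]]] := in_kf_affine f1 kft kf.
have kE h : in_kf ft h <-> in_kf f h by rewrite ftE; apply: in_kf_affine_eq.
have LfgE y h : Lfg ft y h <-> Lfg f y h.
  by split=> /Lfg_in_kfE[c /kE kc ->]; apply/Lfg_in_kfE; exists c.
(* The derivatives of [ft] and [f] differ by the scalar [a], so both polynomials impose the same
   conditions. *)
have dE h : in_kf ft (ft^`() * h) <-> in_kf f (f^`() * h).
  rewrite kE ftE derivD derivC addr0 derivZ -scalerAl.
  split; last exact: in_kfZ.
  by move/(in_kfZ a^-1); rewrite scalerA mulVf // scale1r.
have gfE y : is_gf ft y <-> is_gf f y.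
  by split=> -[ym /dE ky ymin]; split=> // y' y'm /dE ky'; apply: ymin.
(* Euclidean division: the remainder would contradict the minimality of [g]. *)
have [q gtE] : exists q : {poly R}, gt = (q \Po f) * g.
  have [w gE] := is_gf_generates f1 df0 gfP kg.
  have [h hE] := is_gf_generates f1 df0 gfP (LK gt Lgt).
  have w0 : w != 0 by apply: contraNneq g0 => w0; rewrite gE w0 comp_poly0 mul0r.
  exists (h %/ w); pose d := gt - ((h %/ w) \Po f) * g.
  have dE' : d = ((h %% w) \Po f) * gf.
    by rewrite /d gE hE {1}(divp_eq h w) comp_polyD comp_polyM; ring.
  apply/eqP; rewrite -subr_eq0 -/d; apply: contraT => d0.
  (* The remainder [d] is a combination over [k[f]] of [gt] and [g], both of which generate inside
     [L]. *)
  have dL : psub (Lfg f d) L.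
    move=> _ [y ->].
    have -> : (y \Po f) * d = (y \Po f) * gt + ((- y * (h %/ w)) \Po f) * g.
      by rewrite comp_polyM rmorphN /= /d; ring.
    case: hL => _ LD _ _; apply: LD; last by apply: gL; eexists.
    by apply: gtL; apply/LfgE; exists y.
  have : (size g <= size ((lead_coef d)^-1 *: d)%R)%N.
    apply: gmin; split; first exact: monic_lead_scale; last exact: Lfg_scale.
    apply: in_kf_lead_scale; apply: LK; apply: dL.
    by exists 1; rewrite comp_polyC mul1r.
  rewrite size_scale ?invr_eq0 ?lead_coef_eq0 // leqNgt => /negP[].
  have gf0 : gf != 0 by case: gfP => /monic_neq0.
  have h0 : (h %% w) \Po f != 0.
    by apply: contraNneq d0 => h0; rewrite dE' h0 mul0r.
  rewrite dE' gE !size_mul // ?comp_poly_eq0 //.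
  have := ltn_size_comp f1 (h %% w) w; rewrite ltn_modp => /(_ w0).
  move: gf0; rewrite -size_poly_gt0.
  by move: (size gf) (size ((h %% w) \Po f)) (size (w \Po f)); clear; lia.
split.
- by exists a, b.
- by exists q.
- move=> h; split=> -[y [/gfE yP /LfgE yh]]; by exists y.
- by move=> _ /LfgE[y ->]; exists (y * q); rewrite comp_polyM gtE mulrA.
Qed.
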